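(* Let $\alpha_x,\alpha_t$ be nonzero real numbers and let $\vec u(x,y,z,t)\in\mathbb{R}^3$, $p(x,y,z,t)\in\mathbb{R}$ be a sufficiently smooth solution, for $(x,y,z)\in\mathbb{R}^3$ and $t>0$, of the system $$\frac{\partial \vec u}{\partial t}+(\vec u\cdot\nabla)\vec u=\nu\Delta\vec u-\nabla p,\qquad \nabla\cdot\vec u=0,$$ $$(\vec r\cdot\nabla)\vec u+t\,\frac{\alpha_t}{\alpha_x}\frac{\partial\vec u}{\partial t}=\frac{\alpha_x-\alpha_t}{\alpha_x}\,\vec u,\qquad (\vec r\cdot\nabla)p+t\,\frac{\alpha_t}{\alpha_x}\frac{\partial p}{\partial t}=\frac{2(\alpha_x-\alpha_t)}{\alpha_x}\,p,$$ where $\vec r=(x,y,z)$. Then there exist functions $\mathbf F:\mathbb{R}^3\to\mathbb{R}^3$ and $F:\mathbb{R}^3\to\mathbb{R}$ such that for all $(x,y,z)\in\mathbb{R}^3$ and $t>0$ $$\vec u=t^{\frac{\alpha_x-\alpha_t}{\alpha_t}}\,\mathbf F\!\left(\frac{x}{t^{\alpha_x/\alpha_t}},\frac{y}{t^{\alpha_x/\alpha_t}},\frac{z}{t^{\alpha_x/\alpha_t}}\right),\qquad p=t^{\frac{2(\alpha_x-\alpha_t)}{\alpha_t}}\,F\!\left(\frac{x}{t^{\alpha_x/\alpha_t}},\frac{y}{t^{\alpha_x/\alpha_t}},\frac{z}{t^{\alpha_x/\alpha_t}}\right).$$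
   Context: The first two equations are the incompressible Navier--Stokes equations with kinematic viscosity $\nu$ ($p$ is pressure divided by the constant density). The last two are the isobarity conditions expressing that $\vec u$ and $p$ have weights $\alpha_x-\alpha_t$ and $2(\alpha_x-\alpha_t)$ under the scaling $(x,y,z)\mapsto k^{\alpha_x}(x,y,z)$, $t\mapsto k^{\alpha_t}t$, $k>0$. *)

(* Defs.v *)
From mathcomp Require Import all_boot all_order all_algebra.
From mathcomp Require Import all_classical all_reals all_analysis.

Set Implicit Arguments.
Unset Strict Implicit.
Unset Printing Implicit Defensive.

Import Order.TTheory GRing.Theory Num.Theory.
Import numFieldNormedType.Exports.

Local Open Scope classical_set_scope.
Local Open Scope ring_scope.

(* [U] is meant to be open. In finite dimension, continuity of all the
   directional derivatives is continuity of the differential. *)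
Fixpoint Ck (R : realType) (V W : normedModType R) (k : nat) (U : set V)
    (f : V -> W) : Prop :=
  match k with
  | 0%N => forall x, U x -> {for x, continuous f}
  | k'.+1 => (forall x, U x -> differentiable f x) /\
             (forall v, Ck k' U ('D_v f))
  end.

(* The functions below are fields on R^n at a fixed time: for a time-dependent
   field [u : 'rV[R]_n -> R -> W], the spatial operators are applied to the
   slice [u^~ t]. *)
Definition pderiv (R : realType) (n : nat) (W : normedModType R) (i : 'I_n)
    (f : 'rV[R]_n -> W) : 'rV[R]_n -> W :=
  'D_(delta_mx 0 i : 'rV[R]_n) f.

(* (a . nabla) f *)
Definition advect (R : realType) (n : nat) (W : normedModType R)
    (a : 'rV[R]_n) (f : 'rV[R]_n -> W) (r : 'rV[R]_n) : W :=
  \sum_(i < n) a 0 i *: pderiv i f r.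

Definition laplacian (R : realType) (n : nat) (W : normedModType R)
    (f : 'rV[R]_n -> W) (r : 'rV[R]_n) : W :=
  \sum_(i < n) pderiv i (pderiv i f) r.

Definition grad (R : realType) (n : nat) (f : 'rV[R]_n -> R) (r : 'rV[R]_n) :
    'rV[R]_n :=
  \row_(i < n) pderiv i f r.

Definition divergence (R : realType) (n : nat) (v : 'rV[R]_n -> 'rV[R]_n)
    (r : 'rV[R]_n) : R :=
  \sum_(i < n) pderiv i (fun s => v s 0 i) r.

Definition positive_time (R : realType) (n : nat) : set ('rV[R]_n * R) :=
  [set q | 0 < q.2].

(* Regularity of a classical solution: the velocity is C^1 jointly in space and
   time and C^2 in space at each positive time; the pressure is C^1. *)
Definition smooth_velocity (R : realType) (n : nat)
    (u : 'rV[R]_n -> R -> 'rV[R]_n) : Prop :=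
  Ck 1 (@positive_time R n) (fun q : 'rV[R]_n * R => u q.1 q.2) /\
  (forall t, 0 < t -> Ck 2 [set: 'rV[R]_n] (u^~ t)).

Definition smooth_pressure (R : realType) (n : nat)
    (p : 'rV[R]_n -> R -> R) : Prop :=
  Ck 1 (@positive_time R n) (fun q : 'rV[R]_n * R => p q.1 q.2).

(* Main.v *)
Require Import Defs.
From mathcomp Require Import all_boot all_order all_algebra.
From mathcomp Require Import all_classical all_reals all_analysis.
From mathcomp Require Import ring.

Import Order.TTheory GRing.Theory Num.Theory.
Import numFieldNormedType.Exports.

Set Implicit Arguments.
Unset Strict Implicit.
Unset Printing Implicit Defensive.

Local Open Scope classical_set_scope.
Local Open Scope ring_scope.

(** The isobarity conditions are Euler's differential equation for weighted
    homogeneous functions.  Multiplied by ax, they say that at every point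
    (r, t) with t > 0 the differential of f (a field of weight c, as a function
    of space and time together) sends (ax r, at_ t) to c f(r, t).  That vector
    is the velocity of the one-parameter group of dilations
    (r, t) |-> (k^ax r, k^at_ t), with k = e^s, so along each orbit f solves
    the linear equation df/ds = c f, whence f(k^ax r, k^at_ t) = k^c f(r, t)
    ([weighted_euler], [weighted_euler_row]).  As at_ != 0, the orbit of
    (r, t) meets the hyperplane t = 1, at k = t^(-1/at_).  The value of f
    there determines f on the whole orbit, so the restriction of f to t = 1
    is the profile of the similarity form ([self_similar]). *)

(** Chain rule along a curve: [c] has a one-dimensional source, so its velocity
    carries its whole differential. *)
Lemma derive_along_curve (R : realType) (V W : normedModType R) (c : R -> V)
    (f : V -> W) (s : R) (v : V) :
  is_derive s 1 c v -> differentiable f (c s) ->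
  is_derive s 1 (f \o c) ('d f (c s) v).
Proof.
move=> [dc <-] df; have /derivable1_diffP dc' := dc.
have dfc : differentiable (f \o c) s by exact: differentiable_comp.
split; first exact: diff_derivable.
rewrite deriveE; last exact: dfc.
rewrite diff_comp; [|exact: dc'|exact: df].
by rewrite /= -(deriveE _ dc').
Qed.

Lemma is_derive_expM (R : realType) (a s : R) :
  is_derive s 1 (fun s => expR (a * s)) (a * expR (a * s)).
Proof.
have d : is_derive s (1 : R) (fun s => a * s) a.
  have := is_deriveZ a (is_derive_id s (1 : R)).
  by rewrite /GRing.scale/= mulr1.
by rewrite mulrC; apply: is_derive1_comp.
Qed.

(** The group parameter enters through [expR], so that the orbits are defined for
    every real [s] and the constancy theorem applies on the whole line. *)
Definition dilation (R : realType) (V : normedModType R) (a b : R) (q : V * R)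
    (s : R) : V * R :=
  (expR (a * s) *: q.1, expR (b * s) * q.2).

Lemma is_derive_dilation (R : realType) (V : normedModType R) (a b : R)
    (q : V * R) (s : R) :
  is_derive s 1 (dilation a b q)
    (a *: (dilation a b q s).1, b * (dilation a b q s).2).
Proof.
have d1 (W : normedModType R) (w : W) (c : R) :
    is_derive s 1 (fun s : R => expR (c * s) *: w) (c *: (expR (c * s) *: w)).
  have df : differentiable (fun k : R => k *: w) (expR (c * s)) by [].
  have := derive_along_curve (is_derive_expM c s) df.
  by rewrite diff_val scalerA.
have [da ea] := d1 V q.1 a.
have [db eb] := d1 R q.2 b.
have /derivable1_diffP fa := da.
have /derivable1_diffP fb := db.
split; first by apply/diff_derivable/differentiable_pair.
rewrite deriveE; last exact: differentiable_pair.
by rewrite diff_pair//= -!deriveE// ea eb.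
Qed.

(** The quotient of [f] along an orbit by the expected factor [expR (c * s)] has
    zero derivative. *)
Lemma weighted_euler (R : realType) (V : normedModType R) (a b c : R)
    (f : V * R -> R) :
  (forall q : V * R, 0 < q.2 -> differentiable f q) ->
  (forall q : V * R, 0 < q.2 -> 'd f q (a *: q.1, b * q.2) = c * f q) ->
  forall (q : V * R) s, 0 < q.2 -> f (dilation a b q s) = expR (c * s) * f q.
Proof.
move=> df hf q s q0.
have pos x : 0 < (dilation a b q x).2 by rewrite /= mulr_gt0 ?expR_gt0.
pose g x := expR (- c * x) * f (dilation a b q x).
have dg x : is_derive x (1 : R) g 0.
  have de := is_derive_expM (- c) x.
  have dc := derive_along_curve (is_derive_dilation a b q x) (df _ (pos x)).
  apply: is_derive_eq.
  rewrite (hf _ (pos x)) /GRing.scale/=; ring.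
have := is_derive_0_is_cst s 0 dg.
rewrite /g /dilation !mulr0 expR0 !mul1r scale1r -surjective_pairing => <-.
by rewrite mulrA -expRD mulNr subrr expR0 mul1r.
Qed.

(** The constancy theorem behind [weighted_euler] is for real functions, hence
    the passage through coordinates. *)
Lemma weighted_euler_row (R : realType) (n : nat) (V : normedModType R)
    (a b c : R) (f : V * R -> 'rV[R]_n) :
  (forall q : V * R, 0 < q.2 -> differentiable f q) ->
  (forall q : V * R, 0 < q.2 -> 'd f q (a *: q.1, b * q.2) = c *: f q) ->
  forall (q : V * R) s, 0 < q.2 -> f (dilation a b q s) = expR (c * s) *: f q.
Proof.
move=> df hf q s q0; apply/rowP => j; rewrite mxE.
have dfj (x : V * R) : 0 < x.2 -> differentiable (fun q => f q 0 j) x.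
  move=> /df dfx.
  apply: (differentiable_comp (g := fun v : 'rV[R]_n => v 0 j) dfx).
  exact: differentiable_coord.
apply: (weighted_euler (f := fun q => f q 0 j)) q0 => // {s}{}q q0.
have := hf q q0; rewrite -deriveE; last exact: df.
rewrite -deriveE; last exact: dfj.
rewrite derive_mx; last exact: diff_derivable (df q q0).
by move=> /rowP /(_ j); rewrite !mxE.
Qed.

Lemma derive_slice_space (R : realType) (V W : normedModType R)
    (f : V -> R -> W) (r v : V) (t : R) :
  'D_(v, 0) (fun q : V * R => f q.1 q.2) (r, t) = 'D_v (f^~ t) r.
Proof.
rewrite /derive; set d := fun _ : R => _; set d' := fun _ : R => _.
suff -> : d = d' by []; apply/funext => h; rewrite /d /d' /=.
by rewrite /GRing.scale/= mulr0 add0r.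
Qed.

Lemma derive_slice_time (R : realType) (V W : normedModType R)
    (f : V -> R -> W) (r : V) (t : R) :
  'D_(0, 1) (fun q : V * R => f q.1 q.2) (r, t) = derive1 (f r) t.
Proof.
rewrite derive1E /derive; set d := fun _ : R => _; set d' := fun _ : R => _.
suff -> : d = d' by []; apply/funext => h; rewrite /d /d' /=.
by rewrite scaler0 add0r.
Qed.

(** Total differentiability is what makes the partial derivatives in space and
    time add up to the differential: decompose (v, k) on the standard basis. *)
Lemma diff_advect (R : realType) (n : nat) (W : normedModType R)
    (f : 'rV[R]_n -> R -> W) (r v : 'rV[R]_n) (t k : R) :
  differentiable (fun q : 'rV[R]_n * R => f q.1 q.2) (r, t) ->
  'd (fun q : 'rV[R]_n * R => f q.1 q.2) (r, t) (v, k) =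
  advect v (f^~ t) r + k *: derive1 (f r) t.
Proof.
move=> df.
have -> : (v, k) = \sum_i v 0 i *: (delta_mx 0 i : 'rV[R]_n, 0 : R) + k *: (0, 1).
  apply/pair_equal_spec; split => /=.
    rewrite scaler0 addr0 [LHS]row_sum_delta.
    by elim/big_rec2: _ => // i x y _ ->.
  rewrite [X in X + _](_ : _ = 0) ?add0r; first by rewrite /GRing.scale/= mulr1.
  by elim/big_rec: _ => // i x _ /= ->; rewrite /GRing.scale/= mulr0 add0r.
rewrite linearD linearZ linear_sum -deriveE// derive_slice_time; congr (_ + _).
by apply: eq_bigr => i _; rewrite linearZ -deriveE// derive_slice_space.
Qed.

(** Slide (r, t) along its orbit to time 1, where the parameter is
    - ln t / b. *)
Lemma self_similar (R : realType) (V W : normedModType R) (a b c : R)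
    (f : V -> R -> W) : b != 0 ->
  (forall (q : V * R) s, 0 < q.2 -> f (dilation a b q s).1 (dilation a b q s).2
                        = expR (c * s) *: f q.1 q.2) ->
  forall r t, 0 < t -> f r t = t `^ (c / b) *: f ((t `^ (a / b))^-1 *: r) 1.
Proof.
move=> b0 hf r t t0.
have := hf (r, t) (- (ln t / b)) t0.
rewrite /dilation /=.
have -> : expR (b * - (ln t / b)) * t = 1.
  rewrite mulrN mulrCA mulfV// mulr1 expRN lnK ?posrE// mulVf//.
  by rewrite gt_eqF.
have pE x : expR (x * - (ln t / b)) = (t `^ (x / b))^-1.
  by rewrite -powRN /powR gt_eqF//; congr expR; field.
rewrite !pE => ->.
by rewrite scalerA mulfV ?scale1r// gt_eqF// powR_gt0.
Qed.

Theorem mainTheorem2 (R : realType) (ax at_ nu : R)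
    (u : 'rV[R]_3 -> R -> 'rV[R]_3) (p : 'rV[R]_3 -> R -> R)
    (ax_neq0 : ax != 0) (at_neq0 : at_ != 0)
    (u_smooth : smooth_velocity u) (p_smooth : smooth_pressure p)
    (momentum : forall (r : 'rV[R]_3) (t : R), 0 < t ->
       derive1 (u r) t + advect (u r t) (u^~ t) r
       = nu *: laplacian (u^~ t) r - grad (p^~ t) r)
    (incompressible : forall (r : 'rV[R]_3) (t : R), 0 < t -> divergence (u^~ t) r = 0)
    (u_isobaric : forall (r : 'rV[R]_3) (t : R), 0 < t ->
       advect r (u^~ t) r + (t * (at_ / ax)) *: derive1 (u r) t
       = ((ax - at_) / ax) *: u r t)
    (p_isobaric : forall (r : 'rV[R]_3) (t : R), 0 < t ->
       advect r (p^~ t) r + t * (at_ / ax) * derive1 (p r) t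
       = (2 * (ax - at_) / ax) * p r t) :
  exists (F : 'rV[R]_3 -> 'rV[R]_3) (G : 'rV[R]_3 -> R),
    forall (r : 'rV[R]_3) (t : R), 0 < t ->
      u r t = t `^ ((ax - at_) / at_) *: F ((t `^ (ax / at_))^-1 *: r) /\
      p r t = t `^ (2 * (ax - at_) / at_) * G ((t `^ (ax / at_))^-1 *: r).
Proof.
have [u_diff _] := u_smooth.1.
have [p_diff _] := p_smooth.
exists (u^~ 1), (p^~ 1) => r t t0; split.
  apply: (self_similar (f := u)) t0 => // q s q0.
  apply: (weighted_euler_row (f := fun q => u q.1 q.2)) q0 => //.
  move=> {s}[{}r {}t] /= t0; rewrite (diff_advect _ _ (u_diff (r, t) t0)).
  (* Clearing the denominator ax turns isobarity into Euler's equation. *)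
  have /(congr1 (fun v => ax *: v)) := u_isobaric r t t0.
  rewrite scalerDr !scalerA.
  have -> : ax * (t * (at_ / ax)) = at_ * t by field.
  have -> : ax * ((ax - at_) / ax) = ax - at_ by field.
  move=> <-; congr (_ + _); rewrite /advect scaler_sumr.
  by apply: eq_bigr => i _; rewrite mxE scalerA.
apply: (self_similar (f := p)) t0 => // q s q0.
apply: (weighted_euler (f := fun q => p q.1 q.2)) q0 => //.
move=> {s}[{}r {}t] /= t0; rewrite (diff_advect _ _ (p_diff (r, t) t0)).
have /(congr1 (fun v => ax * v)) := p_isobaric r t t0.
rewrite mulrDr !mulrA.
have -> : ax * t * at_ / ax = at_ * t by field.
have -> : ax * 2 * (ax - at_) / ax = 2 * (ax - at_) by field.
move=> <-; congr (_ + _); rewrite /advect mulr_sumr.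
by apply: eq_bigr => i _; rewrite mxE /GRing.scale/= mulrA.
Qed.
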